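(* Let $N\ge2$, $0<|q|<1$, and let $s_i(z)$, $1\le i\le N-1$, be generating functions with mode Poisson brackets $\{s_i(n),s_j(m)\}_{(k)}$ defined in the context. When one chooses $k=0$ for all sectors, one obtains, for all $i,j\in\{1,\dots,N-1\}$ and $n,m\in\mathbb Z$, $$\{s_i(n),s_j(m)\}=-2\ln q\,(q-q^{-1})\sum_{r\in\mathbb Z}\frac{[(N-\max(i,j))r]_q\,[\min(i,j)r]_q}{[Nr]_q}\,s_i(n-2r)\,s_j(m+2r).$$
   Context: $[r]_q=\frac{q^r-q^{-r}}{q-q^{-1}}$; the $r=0$ term of the sum is understood as its limit, namely $0$. $\ln q$ is a fixed logarithm of $q$ and $q^a=e^{a\ln q}$. Let $$f(x)=-2\ln q\Big[\sum_{\ell\ge0}\Big(\frac{2x^2q^{2N\ell}}{1-x^2q^{2N\ell}}-\frac{x^2q^{2N\ell+2}}{1-x^2q^{2N\ell+2}}-\frac{x^2q^{2N\ell-2}}{1-x^2q^{2N\ell-2}}\Big)-\frac{x^2}{1-x^2}+\frac12\frac{x^2q^2}{1-x^2q^2}+\frac12\frac{x^2q^{-2}}{1-x^2q^{-2}}-(x\leftrightarrow x^{-1})\Big],$$ where $-(x\leftrightarrow x^{-1})$ means subtracting the whole preceding bracketed expression with $x$ replaced by $x^{-1}$. In the paper $\{t(z),t(w)\}=f(w/z)t(z)t(w)$ is the Poisson bracket of the trace generators of $\mathcal A_{q,p}(\widehat{sl}(N)_c)$ at $c=-N$, and $s_i(z)=\prod_{u=-(i-1)/2}^{(i-1)/2}t(q^uz)$,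 so that $$\{s_i(z),s_j(w)\}=f_{ij}(w/z)\,s_i(z)\,s_j(w),\qquad f_{ij}(x)=\sum_{u=-(i-1)/2}^{(i-1)/2}\ \sum_{v=-(j-1)/2}^{(j-1)/2}f(q^{v-u}x)$$ (sums in unit steps). The modes are $s_i(n)=\oint\frac{dz}{2\pi iz}z^{-n}s_i(z)$, the $s_i(n)$ being treated as commuting variables. Mode brackets. Candidate singularities of $f_{ij}(x)$ lie at $|x|=|q|^{P}$ with $P\in\{\pm N\ell+v:\ \ell\in\mathbb Z_{\ge0},\ v\in\{-\tfrac{i+j}2,-\tfrac{i+j}2+1,\dots,\tfrac{i+j}2\}\}$; let $(P_{ij}(k))_k$ be the increasing enumeration of this set together with $0$, with $P_{ij}(0)=0$. Sector $(k)$ is $\frac{R_1}{R_2}\in\,]|q|^{-P_{ij}(k)},|q|^{-P_{ij}(k+1)}[$ (so for $k=0$ it is $]1,|q|^{-1}[$ if $i+j$ is even and $]1,|q|^{-1/2}[$ if $i+j$ is odd). With $C_1,C_2$ circles around $0$ of radii $R_1,R_2$: (a) for $i=j$, $$\{s_i(n),s_i(m)\}_{(k)}=\frac12\Big(\oint_{C_1}\frac{dz}{2\pi iz}\oint_{C_2}\frac{dw}{2\pi iw}+\oint_{C_2}\frac{dz}{2\pi iz}\oint_{C_1}\frac{dw}{2\pi iw}\Big)z^{-n}w^{-m}f_{ii}(w/z)s_i(z)s_i(w);$$ (b) for $i<j$, $\{s_i(n),s_j(m)\}_{(k)}=\oint_{C_1}\frac{dz}{2\pi iz}\oint_{C_2}\frac{dw}{2\pi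 iw}z^{-n}w^{-m}f_{ij}(w/z)s_i(z)s_j(w)$, and $\{s_j(m),s_i(n)\}_{(k)}:=-\{s_i(n),s_j(m)\}_{(k)}$. In each integral $f_{ij}(w/z)$ is replaced by its convergent Laurent series on the relevant circle $|w/z|$, and integration is term by term. *)

(* Defs.v *)
(* MathComp / MathComp-Analysis; complex numbers are R[i] for R : realType,
   with the topology of the numFieldType R[i] (carried by the alias R[i]^o). *)
From HB Require Import structures.
From mathcomp Require Import all_boot all_order all_algebra.
From mathcomp Require Import finmap multiset.
From mathcomp Require Import complex.
From mathcomp Require Import all_classical all_reals all_analysis.

Set Implicit Arguments.
Unset Strict Implicit.
Unset Printing Implicit Defensive.

Import Order.TTheory GRing.Theory Num.Theory numFieldNormedType.Exports.
Local Open Scope classical_set_scope.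
Local Open Scope complex_scope.
Local Open Scope ring_scope.

Section Kernel.
Variable R : realType.
Implicit Types (q lnq x z : R[i]) (i j k N : nat).

Definition expC z : R[i] :=
  (expR (complex.Re z))%:C * (cos (complex.Im z) +i* sin (complex.Im z)).

(* q^a = e^(a ln q), needed for half-integral a *)
Definition qpow lnq (a : R) : R[i] := expC (a%:C * lnq).

Definition qint q (r : int) : R[i] := (q ^ r - q ^ (- r)) / (q - q^-1).

Definition csum (u : nat -> R[i]) : R[i] :=
  lim ((fun n => \sum_(0 <= l < n) u l : R[i]^o) @ \oo).

Definition geo x : R[i] := x / (1 - x).

Definition kernel_half N q x : R[i] :=
  csum (fun l => 2 * geo (x ^+ 2 * q ^ (2 * N * l)%:Z)
                 - geo (x ^+ 2 * q ^ ((2 * N * l)%:Z + 2))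
                 - geo (x ^+ 2 * q ^ ((2 * N * l)%:Z - 2)))
  - geo (x ^+ 2) + 2^-1 * geo (x ^+ 2 * q ^+ 2) + 2^-1 * geo (x ^+ 2 * q ^- 2).

Definition kernel_f N q lnq x : R[i] :=
  - 2 * lnq * (kernel_half N q x - kernel_half N q x^-1).

(* the a-th point of -(i-1)/2, -(i-1)/2 + 1, ..., (i-1)/2, for a < i *)
Definition centered i (a : nat) : R := - ((i%:R - 1) / 2) + a%:R.

Definition kernel_fij N q lnq i j x : R[i] :=
  \sum_(a < i) \sum_(b < j)
    kernel_f N q lnq (qpow lnq (centered j b - centered i a) * x).

(* c is the family of coefficients of a Laurent series converging to g on an
   open annulus around the circle |x| = rho; such a c is unique if it exists *)
Definition is_laurent (g : R[i] -> R[i]) (rho : R) (c : int -> R[i]) : Prop :=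
  exists r1 r2 : R, [/\ 0 <= r1, r1 < rho, rho < r2 &
    forall x, r1%:C < `|x| < r2%:C ->
      exists gp gm : R[i]^o, [/\
        (fun n => \sum_(0 <= k < n) c k%:Z * x ^ k%:Z : R[i]^o) @ \oo --> gp,
        (fun n => \sum_(1 <= k < n) c (- k%:Z) * x ^ (- k%:Z) : R[i]^o) @ \oo
          --> gm &
        g x = gp + gm]].

Definition laurent_coef (g : R[i] -> R[i]) (rho : R) : int -> R[i] :=
  xget (fun=> 0) [set c | is_laurent g rho c].

End Kernel.

Section Modes.
Variable R : realType.

(* Possibly infinite formal sums, with coefficients in R[i], of monomials in
   the commuting variables s_i(n); s_i(n) is indexed by (i, n) and a monomial
   is a finite multiset of variables. *)
Definition fseries : Type := {mset (nat * int)%type}%mset -> R[i].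

(* s_i(n) s_j(m) *)
Definition smode2 (i : nat) (n : int) (j : nat) (m : int) : fseries :=
  fun M => (M == [mset (i, n); (j, m)]%mset)%:R.

(* Coefficientwise sum over Z. The sum on the right is over the support of
   k |-> u k M, and is 0 by convention if this support is infinite; in all
   uses below it has at most two elements, as u k is a multiple of
   s_i(n + a k) s_j(m - a k) with a <> 0. *)
Definition formal_sum (u : int -> fseries) : fseries :=
  fun M => \sum_(k \in [set: int]) u k M.

(* Formal Laurent series in z, w: F a b is the coefficient of z^a w^b. *)
Definition fseries_zw : Type := int -> int -> fseries.

(* s_i(z) s_j(w): since s_i(n) = \oint dz/(2 pi i z) z^(-n) s_i(z), the
   coefficient of z^n in s_i(z) is s_i(n). *)
Definition gen2 (i j : nat) : fseries_zw := fun a b => smode2 i a j b.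

(* z^(-n) w^(-m) (\sum_k c_k (w/z)^k) F(z, w) *)
Definition kernel_mul (n m : int) (c : int -> R[i]) (F : fseries_zw) :
    fseries_zw :=
  fun a b => formal_sum (fun k => (c k *: F (a + n + k) (b + m - k) : fseries)).

(* Termwise \oint dz/(2 pi i z) \oint dw/(2 pi i w) *)
Definition oint2 (F : fseries_zw) : fseries := F 0 0.

(* The double integral of z^(-n) w^(-m) g(w/z) s_i(z) s_j(w) over |z| = rz and
   |w| = rw, g(w/z) being expanded on |w/z| = rw/rz *)
Definition mode_integral (g : R[i] -> R[i]) (rz rw : R) (i j : nat)
    (n m : int) : fseries :=
  oint2 (kernel_mul n m (laurent_coef g (rw / rz)) (gen2 i j)).

Definition bracket_le (N : nat) (q lnq : R[i]) (R1 R2 : R) (i j : nat)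
    (n m : int) : fseries :=
  let g := kernel_fij N q lnq i j in
  if i == j then
    2^-1 *: (mode_integral g R1 R2 i j n m + mode_integral g R2 R1 i j n m)
  else mode_integral g R1 R2 i j n m.

(* {s_i(n), s_j(m)} for circles C_1, C_2 of radii R1, R2 *)
Definition bracket (N : nat) (q lnq : R[i]) (R1 R2 : R) (i j : nat)
    (n m : int) : fseries :=
  if (i <= j)%N then bracket_le N q lnq R1 R2 i j n m
  else - bracket_le N q lnq R1 R2 j i m n.

Definition Pset (N i j : nat) : set R :=
  [set P | P = 0 \/
    exists (l : int) (t : nat),
      (t <= i + j)%N /\ P = N%:R * l%:~R + (- ((i + j)%:R / 2) + t%:R)].

Definition is_enumeration (S : set R) (P : int -> R) : Prop :=
  [/\ P 0 = 0, {homo P : a b / a < b} & range P = S].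

(* Sector (k), as a set of values of R1/R2; the enumeration P is unique. *)
Definition sector (N : nat) (q : R[i]) (i j : nat) (k : int) : set R :=
  [set rho | exists2 P, is_enumeration (Pset N i j) P &
    (complex.Re `|q|) `^ (- P k) < rho < (complex.Re `|q|) `^ (- P (k + 1))].

End Modes.

(* Main.v *)
Require Import Defs.
From HB Require Import structures.
From mathcomp Require Import all_boot all_order all_algebra.
From mathcomp Require Import finmap multiset.
From mathcomp Require Import complex.
From mathcomp Require Import all_classical all_reals all_analysis.
From mathcomp Require Import cyclic separable cyclotomic.
From mathcomp Require Import ring lra zify.

(** Write y = x^2, p = q^(2N) and geo u = u / (1 - u). The kernel f is, up to
    the factor -2 ln q, minus a second difference of the odd function U(y), the
    symmetrically regularised sum of geo (y p^l) over all integers l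
    ([odd_kernel]): 2 U(y) - U(y q^2) - U(y q^-2). The double sum in f_ij
    telescopes in both indices ([second_difference_sum]), which leaves
      U(y q^(i-j)) + U(y q^(j-i)) - U(y q^(i+j)) - U(y q^(-i-j)).

    The one-sided sums of geo (u p^l) are Lambert series, by the functional
    equation L(u) - L(u p) = geo u ([lambert_shift], [sum_geo_cvg]). Hence U has
    Laurent coefficients e_r = 1 / (1 - p^r), e_0 = 1/2, for |p| < |v| < 1, and
    e_r - 1 for 1 < |v| < 1/|p| ([odd_kernel_laurent_in],
    [odd_kernel_laurent_out]). In sector 0 the four arguments of U lie in these
    annuli; for i < j the sign of the exponent of q tells in which one. Adding up
    the four expansions then gives the coefficient
    2 ln q (q - 1/q) [(N-j) r] [i r] / [N r] of y^r ([structure_coefE]). For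
    i = j the pole of U at 1 lies on the circle |y| = 1, and the coefficients
    on its two sides are the same up to the constants -2 ln q and 2 ln q, the
    two halves of a delta function, which cancel in the mean of the two orders
    of integration ([bracket_leE]).

    Since [laurent_coef] chooses some family of coefficients, these computations
    determine it only through the uniqueness of Laurent coefficients
    ([laurent_coef_eq]). Uniqueness is proved without contour integrals, by
    averaging over roots of unity ([laurent_circle_eq0]). Finally only even
    powers x^(2r) occur, which turns the termwise integral into the sum over r,
    and the case j < i follows from the oddness of the coefficients in r. *)

Set Implicit Arguments.
Unset Strict Implicit.
Unset Printing Implicit Defensive.

Import Order.TTheory GRing.Theory Num.Theory numFieldNormedType.Exports.
Local Open Scope classical_set_scope.
Local Open Scope complex_scope.
Local Open Scope ring_scope.

(** * Sequences and series of complex numbers *)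

Section ComplexSeries.
Variable R : realType.
Implicit Types (u : nat -> R[i]) (z : R[i]).

Lemma gt0_real_complex z : 0 < z -> exists2 e : R, 0 < e & z = e%:C.
Proof.
move=> z0; have zE := RRe_real (gtr0_real z0).
by exists (complex.Re z) => //; rewrite -ltcR zE.
Qed.

Lemma norm_real_complex z : exists2 a : R, 0 <= a & `|z| = a%:C.
Proof. by rewrite normc_def; eexists; last reflexivity; rewrite sqrtr_ge0. Qed.

Lemma cvg_real_complex (u : nat -> R) (l : R) : u @ \oo --> l ->
  (fun n => (u n)%:C : R[i]^o) @ \oo --> (l%:C : R[i]^o).
Proof.
move=> ul; apply/cvgrPdist_lt => z /gt0_real_complex[e e0 ->].
move/cvgrPdist_lt : ul => /(_ e e0); apply: filterS => n.
by rewrite -rmorphB /= normc_def /= expr0n /= addr0 sqrtr_sqr ltcR.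
Qed.

Lemma cvg_exprC z : `|z| < 1 -> (fun n => z ^+ n : R[i]^o) @ \oo --> (0 : R[i]^o).
Proof.
have [a a0 za] := norm_real_complex z; rewrite za -(rmorph1 (real_complex R)) ltcR => a1.
have /cvg_expr /cvg_real_complex h : `|a| < 1 by rewrite ger0_norm.
apply/cvgrPdist_lt => e e0; move/cvgrPdist_lt: h => /(_ e e0); apply: filterS => n /=.
by rewrite !sub0r !normrN normrX za rmorphXn /= ger0_norm ?exprn_ge0// ler0c.
Qed.

Lemma cvgC_unique u (l l' : R[i]) :
  (u : nat -> R[i]^o) @ \oo --> (l : R[i]^o) ->
  (u : nat -> R[i]^o) @ \oo --> (l' : R[i]^o) -> l = l'.
Proof.
move=> h h'; exact: (cvg_unique (@norm_hausdorff _ (R[i]^o)) h h').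
Qed.

Lemma cvgC_lim u (l : R[i]) :
  (u : nat -> R[i]^o) @ \oo --> (l : R[i]^o) ->
  lim ((u : nat -> R[i]^o) @ \oo) = l.
Proof. by move=> h; apply: (cvg_lim (@norm_hausdorff _ (R[i]^o)) h). Qed.

Lemma cvgC_lin (c d a b : R[i]) u v :
  (u : nat -> R[i]^o) @ \oo --> (a : R[i]^o) ->
  (v : nat -> R[i]^o) @ \oo --> (b : R[i]^o) ->
  (fun n => c * u n + d * v n : R[i]^o) @ \oo --> (c * a + d * b : R[i]^o).
Proof.
move=> ua vb.
apply: (@cvgD _ (R[i]^o)).
  exact: (@cvgZl_tmp _ (R[i]^o) _ _ _ c _ _ ua).
exact: (@cvgZl_tmp _ (R[i]^o) _ _ _ d _ _ vb).
Qed.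
Arguments cvgC_lin c d {a b u v}.

Lemma cvgC_eq u v (l l' : R[i]) :
  (u : nat -> R[i]^o) @ \oo --> (l : R[i]^o) -> l = l' ->
  (forall n, (0 < n)%N -> u n = v n) ->
  (v : nat -> R[i]^o) @ \oo --> (l' : R[i]^o).
Proof.
move=> ul <- uv; move: ul; apply: cvg_trans; apply: near_eq_cvg.
by near=> n; apply: uv; near: n; exists 1%N.
Unshelve. all: end_near. Qed.

Lemma cvgC_cst (c : R[i]) : (fun=> c : R[i]^o) @ \oo --> (c : R[i]^o).
Proof. exact: (@cvg_cst R[i]^o). Qed.
Arguments cvgC_cst c : clear implicits.

(** The real and imaginary parts are real series dominated by [v], and
absolutely convergent real series converge; this is how completeness of the
complex numbers enters. *)
Lemma dominated_series_cvg u (v : nat -> R) :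
  (forall n, `|u n| <= (v n)%:C) -> cvgn (series v) ->
  exists l : R[i], (fun n => \sum_(0 <= k < n) u k : R[i]^o) @ \oo --> (l : R[i]^o).
Proof.
move=> uv cv.
have v0 n : 0 <= v n by rewrite -ler0c (le_trans _ (uv n)).
have re n : `|complex.Re (u n)| <= v n.
  by rewrite -lecR (le_trans (normc_ge_Re _)).
have im n : `|complex.Im (u n)| <= v n.
  have -> : complex.Im (u n) = - complex.Re (u n * 'i) by rewrite ReiNIm opprK.
  rewrite normrN -lecR (le_trans (normc_ge_Re _))// normrM.
  suff -> : `|'i : R[i]| = 1 by rewrite mulr1.
  by rewrite normc_def /= expr0n /= expr1n add0r sqrtr1.
have cre : cvgn (series (fun n => complex.Re (u n))).
  apply: normed_cvg; apply: series_le_cvg cv => n //=.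
have cim : cvgn (series (fun n => complex.Im (u n))).
  apply: normed_cvg; apply: series_le_cvg cv => n //=.
set a := limn _ in cre; set b := limn _ in cim.
exists (a%:C + 'i * b%:C).
have /= h1 := cvg_real_complex cre.
have /= h2 := cvg_real_complex cim.
have h3 := cvgC_lin 1 'i h1 h2.
apply: (cvgC_eq h3); first by rewrite mul1r.
move=> n _; rewrite /series /= !rmorph_sum/= mul1r mulr_sumr -big_split/=.
by apply: eq_bigr => k _; exact: esym (complexE _).
Qed.

Lemma cvgC_norm_le (s : nat -> R[i]) (l B : R[i]) :
  (s : nat -> R[i]^o) @ \oo --> (l : R[i]^o) -> (forall n, `|s n| <= B) -> `|l| <= B.
Proof.
move=> sl sB; apply/ler_addgt0Pr => e e0.
move/cvgrPdist_lt : sl => /(_ e e0)[n _ /(_ n (leqnn n))] /= h.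
rewrite -(subrK (s n) l) addrC (le_trans (ler_normD _ _))// lerD//.
exact: ltW.
Qed.

Lemma cvgC_norm0 (s : nat -> R[i]) (B a : R[i]) : `|a| < 1 ->
  (forall n, `|s n| <= B * `|a| ^+ n) ->
  (s : nat -> R[i]^o) @ \oo --> (0 : R[i]^o).
Proof.
move=> a1 sB.
have B0 : 0 <= B by have := sB 0%N; rewrite expr0 mulr1; apply: le_trans.
have := cvgC_lin B 0 (cvg_exprC a1) (cvg_exprC a1).
rewrite mulr0 mul0r addr0 => /cvgrPdist_lt h.
apply/cvgrPdist_lt => e e0; move: (h e e0); apply: filterS => n /=.
rewrite !sub0r !normrN mul0r addr0 normrM normrX; apply: le_lt_trans.
by rewrite (ger0_norm B0).
Qed.

End ComplexSeries.
Arguments cvgC_lin {R} c d {a b u v}.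
Arguments cvgC_cst {R} c.

(** * Lambert series *)

Section Lambert.
Variables (R : realType).
Implicit Types (u v : R[i]).

Lemma geometric_sum1 (a : R[i]) n : a != 1 ->
  \sum_(1 <= k < n.+1) a ^+ k = (a - a ^+ n.+1) / (1 - a).
Proof.
move=> a1; have a1' : 1 - a != 0 by rewrite subr_eq0 eq_sym.
elim: n => [|n IH]; first by rewrite big_geq// expr1 subrr mul0r.
by rewrite big_nat_recr//= IH !exprS; field.
Qed.

Lemma geo_cvg u : `|u| < 1 ->
  (fun n => \sum_(1 <= k < n) u ^+ k : R[i]^o) @ \oo --> (geo u : R[i]^o).
Proof.
move=> u1; rewrite -cvg_shiftS.
have un1 : u != 1 by apply: contraTneq u1 => ->; rewrite normr1 ltxx.
have h0 := cvgC_cst u.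
have h1 := cvgC_lin (1 - u)^-1 (- (u * (1 - u)^-1)) h0 (cvg_exprC u1).
apply: (cvgC_eq h1).
  by rewrite mulr0 addr0 mulrC.
by move=> n _ /=; rewrite geometric_sum1// exprS; ring.
Qed.

Variable p : R[i].
Hypothesis p1 : `|p| < 1.

Lemma one_sub_expr_neq0 k : (0 < k)%N -> 1 - p ^+ k != 0.
Proof.
move=> k0; rewrite subr_eq0; apply/eqP => /(congr1 Num.norm).
rewrite normr1 normrX => /esym/eqP; rewrite lt_eqF//.
by rewrite exprn_ilt1// -lt0n.
Qed.

(** Obtained from the sum over l of [geo (u * p ^+ l)] by expanding each term
geometrically and summing over l first. *)
Definition lambert u : R[i] :=
  lim ((fun n => \sum_(1 <= k < n) u ^+ k / (1 - p ^+ k) : R[i]^o) @ \oo).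

Lemma lambert_term u k : (0 < k)%N ->
  `|u ^+ k / (1 - p ^+ k)| <= `|u| ^+ k / (1 - `|p|).
Proof.
move=> k0; rewrite normrM normrX normfV ler_wpM2l ?exprn_ge0//.
have h : 1 - `|p| <= `|1 - p ^+ k|.
  rewrite (le_trans _ (lerB_dist _ _))// normr1 lerD2l lerN2 normrX.
  by rewrite -[leRHS]expr1 ler_wiXn2l// ltW.
by rewrite lef_pV2// posrE ?(lt_le_trans _ h)// subr_gt0.
Qed.

Lemma lambert_cvg u : `|u| < 1 ->
  (fun n => \sum_(1 <= k < n) u ^+ k / (1 - p ^+ k) : R[i]^o) @ \oo -->
  (lambert u : R[i]^o).
Proof.
move=> u1.
suff [l hl] : exists l : R[i],
  (fun n => \sum_(1 <= k < n) u ^+ k / (1 - p ^+ k) : R[i]^o) @ \oo --> (l : R[i]^o).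
  by rewrite /lambert (cvgC_lim hl).
have [a a0 ua] := norm_real_complex u.
have [b b0 pb] := norm_real_complex p.
have a1 : a < 1 by rewrite -ltcR -ua.
have b1 : b < 1 by rewrite -ltcR -pb.
pose f k := if k == 0%N then 0 else u ^+ k / (1 - p ^+ k).
have [l hl] : exists l : R[i],
    (fun n => \sum_(0 <= k < n) f k : R[i]^o) @ \oo --> (l : R[i]^o).
  apply: (dominated_series_cvg (v := geometric (1 - b)^-1 a)).
    move=> k; rewrite /f; have [->|k0] := eqVneq k 0%N.
      by rewrite normr0 /= expr0 mulr1 ler0c invr_ge0 subr_ge0 ltW.
    rewrite (le_trans (lambert_term _ _)) ?lt0n// ua pb.
    by rewrite rmorphM fmorphV rmorphB rmorph1 rmorphXn /= mulrC.
  by apply: is_cvg_geometric_series; rewrite ger0_norm.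
exists l; apply: (cvgC_eq hl) => [|n n0]; first exact: erefl.
rewrite big_ltn//= add0r; apply: eq_big_nat => k /andP[k0 _].
by rewrite /f gtn_eqF.
Qed.

(** Makes the remainder [lambert (u * p ^+ n)] in [sum_geo] tend to 0. *)
Lemma lambert_bound u : `|u| < 1 ->
  `|lambert u| <= `|u| / ((1 - `|u|) * (1 - `|p|)).
Proof.
move=> u1; apply: (cvgC_norm_le (lambert_cvg u1)) => n.
rewrite (le_trans (ler_norm_sum _ _ _))//.
apply: (@le_trans _ _ (\sum_(1 <= k < n) `|u| ^+ k / (1 - `|p|))).
  rewrite big_nat_cond [leRHS]big_nat_cond; apply: ler_sum => k /andP[/andP[k0 _] _].
  exact: lambert_term.
rewrite -mulr_suml invfM mulrA; apply: ler_wpM2r.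
  by rewrite invr_ge0 subr_ge0 ltW.
case: n => [|n].
  by rewrite big_geq// mulr_ge0// invr_ge0 subr_ge0 ltW.
rewrite geometric_sum1 ?lt_eqF//; apply: ler_wpM2r.
  by rewrite invr_ge0 subr_ge0 ltW.
by rewrite gerBl exprn_ge0.
Qed.

Lemma normM_lt1 u : `|u| < 1 -> `|u * p| < 1.
Proof. by move=> u1; rewrite normrM mulr_ilt1. Qed.

(** Termwise, [u ^+ k * (1 - p ^+ k) / (1 - p ^+ k) = u ^+ k]. This functional
equation replaces an exchange of two infinite sums: iterating it telescopes
the partial sums over l. *)
Lemma lambert_shift u : `|u| < 1 -> lambert u - lambert (u * p) = geo u.
Proof.
move=> u1; apply: (cvgC_unique _ (geo_cvg u1)).
apply: (cvgC_eq (cvgC_lin 1 (-1) (lambert_cvg u1) (lambert_cvg (normM_lt1 u1)))).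
  by rewrite mul1r mulN1r.
move=> n _; rewrite mul1r mulN1r -sumrB; apply: eq_big_nat => k /andP[k0 _].
have h := one_sub_expr_neq0 k0.
by rewrite exprMn; field.
Qed.

Lemma sum_geo u n : `|u| < 1 ->
  \sum_(0 <= l < n) geo (u * p ^+ l) = lambert u - lambert (u * p ^+ n).
Proof.
move=> u1; elim: n => [|n IH]; first by rewrite big_geq// expr0 mulr1 subrr.
rewrite big_nat_recr//= IH -(@lambert_shift (u * p ^+ n)).
  by rewrite exprSr mulrA addrA subrK.
by rewrite normrM normrX (le_lt_trans _ u1)// ler_piMr// exprn_ile1// ltW.
Qed.

Lemma sum_geo_cvg u : `|u| < 1 ->
  (fun n => \sum_(0 <= l < n) geo (u * p ^+ l) : R[i]^o) @ \oo -->
  (lambert u : R[i]^o).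
Proof.
move=> u1.
have h : (fun n => lambert (u * p ^+ n) : R[i]^o) @ \oo --> (0 : R[i]^o).
  apply: (@cvgC_norm0 _ _ (`|u| / ((1 - `|u|) * (1 - `|p|))) p) => // n.
  have le1 : `|u * p ^+ n| <= `|u|.
    by rewrite normrM normrX ler_piMr// exprn_ile1// ltW.
  rewrite (le_trans (lambert_bound _)) ?(le_lt_trans le1)//.
  rewrite normrM normrX in le1 *; rewrite mulrAC.
  apply: ler_wpM2r; first exact: exprn_ge0.
  apply: ler_wpM2l => //.
  have h0 : 0 < 1 - `|u| by rewrite subr_gt0.
  have h1 : 0 < 1 - `|p| by rewrite subr_gt0.
  have h2 : 1 - `|u| <= 1 - `|u| * `|p| ^+ n by rewrite lerD2l lerN2.
  have h3 := lt_le_trans h0 h2.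
  rewrite lef_pV2 ?posrE ?mulr_gt0//.
  by apply: ler_wpM2r => //; exact: ltW.
apply: (cvgC_eq (cvgC_lin 1 (-1) (cvgC_cst (lambert u)) h)).
  by rewrite mul1r mulr0 addr0.
by move=> n _; rewrite mul1r mulN1r sum_geo.
Qed.

Definition geo_sum v : R[i] := csum (fun l => geo (v * p ^+ l)).

Lemma geo_sum_cvg_shift v (s : R[i]) :
  (fun n => \sum_(0 <= l < n) geo (v * p * p ^+ l) : R[i]^o) @ \oo --> (s : R[i]^o) ->
  (fun n => \sum_(0 <= l < n) geo (v * p ^+ l) : R[i]^o) @ \oo -->
    (geo v + s : R[i]^o).
Proof.
move=> h; rewrite -cvg_shiftS.
apply: (cvgC_eq (cvgC_lin 1 1 (cvgC_cst (geo v)) h)); first by rewrite !mul1r.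
move=> n _ /=; rewrite !mul1r big_nat_recl//= expr0 mulr1; congr (_ + _).
by apply: eq_bigr => k _; rewrite exprS mulrA.
Qed.

(** As [v * p ^+ l] tends to 0, all but finitely many terms fall in the disc where
[sum_geo_cvg] applies. *)
Lemma geo_sum_cvg v :
  (fun n => \sum_(0 <= l < n) geo (v * p ^+ l) : R[i]^o) @ \oo -->
  (geo_sum v : R[i]^o).
Proof.
suff [s hs] : exists s : R[i],
  (fun n => \sum_(0 <= l < n) geo (v * p ^+ l) : R[i]^o) @ \oo --> (s : R[i]^o).
  by rewrite /geo_sum /csum (cvgC_lim hs).
have [n vn] : exists n, `|v * p ^+ n| < 1.
  have := cvgC_lin v 0 (cvg_exprC p1) (cvg_exprC p1).
  rewrite mulr0 mul0r addr0 => /cvgrPdist_lt/(_ 1 ltr01)[n _ /(_ n (leqnn n))] /=.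
  by rewrite sub0r normrN mul0r addr0; exists n.
elim: n v vn => [|n IH] v vn.
  by rewrite expr0 mulr1 in vn; exists (lambert v); exact: sum_geo_cvg.
have [|s hs] := IH (v * p); first by rewrite -mulrA -exprS.
by exists (geo v + s); exact: geo_sum_cvg_shift.
Qed.
Arguments geo_sum_cvg v : clear implicits.

Lemma geo_sum_shift v : geo_sum v = geo v + geo_sum (v * p).
Proof.
exact: cvgC_unique (geo_sum_cvg v) (geo_sum_cvg_shift (geo_sum_cvg (v * p))).
Qed.

Lemma geo_sum_lambert u : `|u| < 1 -> geo_sum u = lambert u.
Proof.
by move=> u1; apply: (cvgC_unique (geo_sum_cvg u)); apply: sum_geo_cvg.
Qed.

End Lambert.
Arguments geo_sum_cvg {R p} p1 v.

(** * Laurent series at a point *)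

Section LaurentAt.
Variable R : realType.
Implicit Types (c d : int -> R[i]) (x s t a b w : R[i]).

(** Convergence of the Laurent series [c] at the single point [x], with sum [s];
the two halves have the shape required by [is_laurent]. *)
Definition laurent_at c x s : Prop :=
  exists gp gm : R[i]^o, [/\
    (fun n => \sum_(0 <= k < n) c k%:Z * x ^ k%:Z : R[i]^o) @ \oo --> gp,
    (fun n => \sum_(1 <= k < n) c (- k%:Z) * x ^ (- k%:Z) : R[i]^o) @ \oo --> gm
    & s = gp + gm].

Lemma laurent_at_lin c d x s t a b : laurent_at c x s -> laurent_at d x t ->
  laurent_at (fun k => a * c k + b * d k) x (a * s + b * t).
Proof.
move=> [gp [gm [hp hm ->]]] [gp' [gm' [hp' hm' ->]]].
exists (a * gp + b * gp'), (a * gm + b * gm'); split; last by ring.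
- apply: (cvgC_eq (cvgC_lin a b hp hp') (erefl _)) => n _.
  rewrite !mulr_sumr -big_split/=; apply: eq_bigr => k _; ring.
- apply: (cvgC_eq (cvgC_lin a b hm hm') (erefl _)) => n _.
  rewrite !mulr_sumr -big_split/=; apply: eq_bigr => k _; ring.
Qed.

Lemma laurent_at_ext c d x s : c =1 d -> laurent_at c x s -> laurent_at d x s.
Proof. by move=> /funext ->. Qed.

Lemma laurent_at_dilate c x s w : w != 0 -> laurent_at c (x * w) s ->
  laurent_at (fun k => c k * w ^ k) x s.
Proof.
move=> w0 [gp [gm [hp hm ->]]]; exists gp, gm; split; last by [].
- apply: (cvgC_eq hp (erefl _)) => n _; apply: eq_bigr => k _.
  by rewrite expfzMl -mulrA [w ^ _ * _]mulrC.
- apply: (cvgC_eq hm (erefl _)) => n _; apply: eq_bigr => k _.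
  by rewrite expfzMl -mulrA [w ^ _ * _]mulrC.
Qed.

(** Inversion exchanges the two halves, except that the constant term always
belongs to the half of nonnegative powers and has to be moved across. *)
Lemma laurent_at_inv c x s : laurent_at c x^-1 s ->
  laurent_at (fun k => c (- k)) x s.
Proof.
move=> [gp [gm [hp hm ->]]]; exists (c 0 + gm), (gp - c 0); split; last by ring.
- apply: (cvgC_eq (cvgC_lin 1 1 (cvgC_cst (c 0)) hm)); first by rewrite !mul1r.
  move=> n n0; rewrite [RHS]big_ltn// !mul1r oppr0 expr0z mulr1; congr (_ + _).
  by apply: eq_bigr => k _; rewrite exprz_inv opprK.
- apply: (cvgC_eq (cvgC_lin 1 (-1) hp (cvgC_cst (c 0)))).
    by rewrite mul1r mulN1r.
  move=> n n0; rewrite [X in 1 * X]big_ltn// mul1r mulN1r expr0z mulr1 addrC addKr.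
  by apply: eq_bigr => k _; rewrite exprz_inv opprK.
Qed.

(** Coefficients in [x] of the series with coefficients [c] in [x ^+ 2]. *)
Definition even_ext c (k : int) : R[i] :=
  if (2 %| k)%Z then c (k %/ 2)%Z else 0.

Lemma cvg_uphalf : uphalf @ \oo --> \oo.
Proof.
move=> A [n _ nA]; exists n.*2 => // m /= nm; apply: nA => /=.
by rewrite geq_uphalf_double (leq_trans nm).
Qed.

Lemma cvgC_uphalf (u : nat -> R[i]) (l : R[i]) :
  (u : nat -> R[i]^o) @ \oo --> (l : R[i]^o) ->
  (fun n => u (uphalf n) : R[i]^o) @ \oo --> (l : R[i]^o).
Proof. by move=> ul; apply: (cvg_comp uphalf _ _ ul); apply: cvg_uphalf. Qed.

(** The bound on [m] covers the two lower limits 0 and 1 of the two halves. *)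
Lemma sum_even_terms (g : nat -> R[i]) m n : (m <= 1)%N ->
  \sum_(m <= k < n) (if odd k then 0 else g k./2) = \sum_(m <= r < uphalf n) g r.
Proof.
move=> m1; elim: n => [|n IH]; first by rewrite !big_geq.
have [nm|mn] := ltnP n m; first by rewrite !big_geq// uphalfE; lia.
rewrite big_nat_recr//= IH uphalfE /=; case: ifPn => [on|en].
  by rewrite addr0 uphalf_half on.
have -> : uphalf n = n./2 by rewrite uphalf_half (negbTE en).
by rewrite big_nat_recr//; lia.
Qed.

Lemma laurent_at_sqr c x s : laurent_at c (x ^+ 2) s -> laurent_at (even_ext c) x s.
Proof.
move=> [gp [gm [hp hm ->]]].
exists gp, gm; split; last by [].
- have h := cvgC_uphalf hp.
  apply: (cvgC_eq h (erefl _)) => n _; rewrite -sum_even_terms//.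
  apply: eq_bigr => k _; rewrite /even_ext.
  have -> : (2 %| k%:Z)%Z = ~~ odd k by rewrite dvdzE /= dvdn2.
  case: ifPn => ok; first by rewrite mul0r.
  have -> : (k%:Z %/ 2)%Z = k./2%:Z by lia.
  rewrite (exprnP x) exprz_exp; congr (_ * x ^ _); lia.
- have h := cvgC_uphalf hm.
  apply: (cvgC_eq h (erefl _)) => n _; rewrite -sum_even_terms//.
  apply: eq_bigr => k _; rewrite /even_ext.
  have -> : (2 %| (- k%:Z))%Z = ~~ odd k by rewrite dvdzE abszN /= dvdn2.
  case: ifPn => ok; first by rewrite mul0r.
  have -> : (- k%:Z %/ 2)%Z = - k./2%:Z by lia.
  rewrite (exprnP x) exprz_exp; congr (_ * x ^ _); lia.
Qed.

End LaurentAt.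

(** * Uniqueness of Laurent coefficients *)

Section LaurentUnique.
Variable R : realType.

Lemma prim_root_exists n : (0 < n)%N -> exists z : R[i], n.-primitive_root z.
Proof.
move=> n0; have [r Dp] := closed_field_poly_normal ('X^n - 1 : {poly R[i]}).
rewrite (monicP _) ?monicXnsubC// scale1r in Dp.
have rn1 : all n.-unity_root r by apply/allP => z; rewrite -root_prod_XsubC -Dp.
have sz_r : (n < (size r).+1)%N by rewrite -(size_prod_XsubC r id) -Dp size_XnsubC.
have [|z] := hasP (has_prim_root n0 rn1 _ sz_r); last by exists z.
by rewrite -separable_prod_XsubC -Dp separable_Xn_sub_1// pnatr_eq0 -lt0n.
Qed.

(** The mean of the k-th powers of the M-th roots of unity: it filters out the
powers that M does not divide. *)
Definition root_avg (M : nat) (z : R[i]) (k : int) : R[i] :=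
  M%:R^-1 * \sum_(t < M) (z ^+ t) ^ k.

Lemma norm_prim_root M (z : R[i]) : M.-primitive_root z -> `|z| = 1.
Proof.
move=> zM; apply/eqP; have M0 := prim_order_gt0 zM.
by rewrite -(pexpr_eq1 M0)// -normrX (prim_expr_order zM) normr1.
Qed.

Lemma norm_expz (x : R[i]) (k : int) : `|x ^ k| = `|x| ^ k.
Proof. by case: k => k; rewrite ?NegzE -?invr_expz -?exprnP ?normfV normrX. Qed.

Lemma root_avg_le1 M z k : M.-primitive_root z -> `|root_avg M z k| <= 1.
Proof.
move=> zM; have M0 := prim_order_gt0 zM.
rewrite normrM normfV normr_nat mulrC ler_pdivrMr ?ltr0n// mul1r.
rewrite (le_trans (ler_norm_sum _ _ _))//.
under eq_bigr => t _ do rewrite norm_expz normrX (norm_prim_root zM) expr1n exp1rz.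
by rewrite sumr_const card_ord.
Qed.

Lemma root_avg0 M z : M.-primitive_root z -> root_avg M z 0 = 1.
Proof.
move=> zM; have M0 := prim_order_gt0 zM.
rewrite /root_avg; under eq_bigr do rewrite expr0z.
by rewrite sumr_const card_ord mulVf// pnatr_eq0 -lt0n.
Qed.

Lemma root_avg_eq0 M z k : M.-primitive_root z -> k != 0 -> (`|k| < M)%N ->
  root_avg M z k = 0.
Proof.
move=> zM k0 kM; have M0 := prim_order_gt0 zM.
have z0 : z != 0 by rewrite -normr_gt0 (norm_prim_root zM).
have zk1 : z ^ k != 1.
  have h n : (0 < n)%N -> (n < M)%N -> z ^+ n != 1.
    by move=> n0 nM; rewrite -(prim_order_dvd zM) gtnNdvd.
  case: k k0 kM => k; first by rewrite -lt0n; exact: h.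
  by move=> _ kM; rewrite NegzE -invr_expz -exprnP invr_eq1; apply: h.
apply/eqP; rewrite mulf_eq0; apply/orP; right.
have : (z ^ k - 1) * \sum_(t < M) (z ^+ t) ^ k = 0.
  under eq_bigr => t _ do rewrite exprnP exprzAC -exprnP.
  by rewrite -subrX1 exprnP exprzAC -exprnP (prim_expr_order zM) exp1rz subrr.
by move/eqP; rewrite mulf_eq0 subr_eq0 (negbTE zk1).
Qed.

Lemma cvgC0_sum (I : Type) (r : seq I) (u : I -> nat -> R[i]) :
  (forall i, (u i : nat -> R[i]^o) @ \oo --> (0 : R[i]^o)) ->
  (fun n => \sum_(i <- r) u i n : R[i]^o) @ \oo --> (0 : R[i]^o).
Proof.
move=> h; elim: r => [|i r IH].
  by apply: (cvgC_eq (cvgC_cst 0) (erefl _)) => n _; rewrite big_nil.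
apply: (cvgC_eq (cvgC_lin 1 1 (h i) IH)); first by rewrite !mulr0 addr0.
by move=> n _; rewrite big_cons !mul1r.
Qed.

Lemma geometric_tail (t : R[i]) m n : 0 <= t -> t < 1 ->
  \sum_(0 <= k < n) (if (m <= k)%N then t ^+ k else 0) <= t ^+ m / (1 - t).
Proof.
move=> t0 t1; rewrite ler_pdivlMr ?subr_gt0//.
suff <- : (\sum_(0 <= k < n) (if (m <= k)%N then t ^+ k else 0)) * (1 - t)
  + t ^+ (maxn m n) = t ^+ m by rewrite lerDl exprn_ge0.
elim: n => [|n IH]; first by rewrite big_geq// mul0r add0r maxn0.
rewrite big_nat_recr//= -{}IH; case: leqP => mn.
  have -> : maxn m n.+1 = n.+1 by lia.
  by rewrite exprS; ring.
have -> : maxn m n.+1 = m by lia.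
by rewrite addr0.
Qed.

Lemma sum_delta (s : R[i]) (k0 : int) n : (`|k0| < n)%N ->
  \sum_(0 <= k < n) (if k%:Z == k0 then s else 0) +
  \sum_(1 <= k < n) (if - k%:Z == k0 then s else 0) = s.
Proof.
case: k0 => k0 k0n.
  rewrite -big_mkcond (big_nat1_eq _ (fun=> s) k0) k0n.
  rewrite big_nat_cond big1 ?addr0// => k /andP[/andP[k1 _] _].
  by case: ifP => //; lia.
have -> : \sum_(0 <= k < n) (if k%:Z == Negz k0 then s else 0) = 0.
  by rewrite big1// => k _; rewrite ifF//; lia.
rewrite add0r.
rewrite NegzE (eq_bigr (fun k => if k == k0.+1 then s else 0)) => [|k _].
  by rewrite -big_mkcond (big_nat1_eq _ (fun=> s) k0.+1) k0n.
by rewrite eqr_opp.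
Qed.

(** A discrete Cauchy formula. Averaging [z ^ (- k0)] times the series over the
M-th roots of unity keeps [b k0] and kills every other coefficient with index
at distance less than M from [k0]; the remaining ones are in the geometric
tail, which vanishes as M grows. *)
Lemma laurent_circle_eq0 (b : int -> R[i]) (C t : R[i]) : 0 <= t -> t < 1 ->
  (forall k : int, `|b k| <= C * t ^+ `|k|%N) ->
  (forall z : R[i], `|z| = 1 -> laurent_at b z 0) -> b =1 (fun=> 0).
Proof.
move=> t0 t1 bC b0 k0.
have C0 : 0 <= C by have := bC 0; rewrite absz0 expr0 mulr1; apply: le_trans.
have key m : `|b k0| <= 2 * C / (1 - t) * `|t| ^+ m.
  rewrite (ger0_norm t0).
  (* With this M, an index k with |k| < m and k <> k0 satisfies 0 < |k - k0| < M. *)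
  pose M := (`|k0| + m).+1; have [z zM] := @prim_root_exists M isT.
  pose chi k := root_avg M z (k - k0).
  pose S n x := \sum_(0 <= k < n) b k%:Z * x ^ k%:Z
              + \sum_(1 <= k < n) b (- k%:Z) * x ^ (- k%:Z).
  have z0 : z != 0 by rewrite -normr_gt0 (norm_prim_root zM).
  have S0 x : `|x| = 1 -> (fun n => S n x : R[i]^o) @ \oo --> (0 : R[i]^o).
    move=> /b0[gp [gm [hp hm s0]]].
    apply: (cvgC_eq (cvgC_lin 1 1 hp hm)); first by rewrite !mul1r -s0.
    by move=> n _; rewrite !mul1r.
  pose A n := \sum_(s < M) (M%:R^-1 * (z ^+ s) ^ (- k0)) * S n (z ^+ s).
  have chiE k u : \sum_(s < M) M%:R^-1 * (z ^+ s) ^ (- k0) * (u * (z ^+ s) ^ k)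
      = u * chi k.
    rewrite /chi /root_avg !mulr_sumr; apply: eq_bigr => s _.
    by rewrite expfzDr ?expf_neq0//; ring.
  have AE n : A n = \sum_(0 <= k < n) b k%:Z * chi k%:Z
              + \sum_(1 <= k < n) b (- k%:Z) * chi (- k%:Z).
    rewrite /A /S; under eq_bigr do rewrite mulrDr.
    rewrite big_split/=; congr (_ + _).
      under eq_bigr do rewrite mulr_sumr.
      by rewrite exchange_big/=; apply: eq_bigr => k _; rewrite chiE.
    under eq_bigr do rewrite mulr_sumr.
    by rewrite exchange_big/=; apply: eq_bigr => k _; rewrite chiE.
  have A0 : (A : nat -> R[i]^o) @ \oo --> (0 : R[i]^o).
    apply: cvgC0_sum => s.
    have h : `|z ^+ s| = 1 by rewrite normrX (norm_prim_root zM) expr1n.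
    apply: (cvgC_eq (cvgC_lin (M%:R^-1 * (z ^+ s) ^ (- k0)) 0 (S0 _ h) (S0 _ h))).
      by rewrite !mulr0 addr0.
    by move=> n _; rewrite mul0r addr0.
  have term k : `|(if k == k0 then b k0 else 0) - b k * chi k| <=
      C * (if (m <= `|k|)%N then t ^+ `|k|%N else 0).
    have [->|kk0] := eqVneq k k0.
      rewrite /chi subrr root_avg0// mulr1 subrr normr0 mulr_ge0//.
      by case: ifP => // _; rewrite exprn_ge0.
    rewrite sub0r normrN normrM; case: leqP => km.
      by rewrite (le_trans _ (bC k))// ler_piMr// root_avg_le1.
    by rewrite /chi root_avg_eq0 ?subr_eq0// ?normr0 ?mulr0//; lia.
  (* The shift by |k0| + 1 ensures that the index k0 occurs in the partial sum. *)
  have bound n : `|b k0 - A (n + `|k0|.+1)%N| <= 2 * C / (1 - t) * t ^+ m.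
    set n' := (n + _)%N.
    rewrite -[X in X - _](@sum_delta (b k0) k0 n') ?leq_addl//.
    rewrite AE opprD addrACA -!sumrB.
    have h : C * \sum_(0 <= k < n') (if (m <= k)%N then t ^+ k else 0) <=
        C * (t ^+ m / (1 - t)) by rewrite ler_wpM2l// geometric_tail.
    have -> : 2 * C / (1 - t) * t ^+ m =
      C * (t ^+ m / (1 - t)) + C * (t ^+ m / (1 - t)) by ring.
    rewrite (le_trans (ler_normD _ _))// lerD// (le_trans _ h)//.
      rewrite (le_trans (ler_norm_sum _ _ _))// mulr_sumr; apply: ler_sum => k _.
      exact: (term k).
    rewrite (le_trans (ler_norm_sum _ _ _))//.
    have n'0 : (0 < n')%N by rewrite /n' addnS.
    rewrite [in leRHS](big_ltn n'0) mulrDr.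
    rewrite -[X in X <= _]add0r lerD//.
      by rewrite mulr_ge0//; case: ifP => // _; rewrite exprn_ge0.
    rewrite mulr_sumr; apply: ler_sum => k _.
    by rewrite (le_trans (term (- k%:Z)))// abszN.
  apply: (@cvgC_norm_le R (fun n => b k0 - A (n + `|k0|.+1)%N)) bound.
  have h : (fun n => A (n + `|k0|.+1)%N : R[i]^o) @ \oo --> (0 : R[i]^o).
    by rewrite (cvg_shiftn _ (A : nat -> R[i]^o)).
  apply: (cvgC_eq (cvgC_lin 1 (-1) (cvgC_cst (b k0)) h)).
    by rewrite mulr0 addr0 mul1r.
  by move=> n _; rewrite mul1r mulN1r.
have t1' : `|t| < 1 by rewrite ger0_norm.
exact: (cvgC_unique (cvgC_cst (b k0)) (cvgC_norm0 t1' key)).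
Qed.

Lemma bounded_terms (u : nat -> R[i]) m (l : R[i]) :
  (fun n => \sum_(m <= k < n) u k : R[i]^o) @ \oo --> (l : R[i]^o) ->
  exists2 B : R[i], 0 <= B & forall k, (m <= k)%N -> `|u k| <= B.
Proof.
move=> /cvgrPdist_lt/(_ 1 ltr01)[n _ hn].
have B0 : 0 <= \sum_(0 <= k < n) `|u k| by apply: sumr_ge0.
exists (1 + 1 + \sum_(0 <= k < n) `|u k|); first by rewrite !addr_ge0.
move=> k mk; have [kn|nk] := ltnP k n.
  rewrite (le_trans _ (_ : \sum_(0 <= k < n) `|u k| <= _)) ?lerDr//.
  by rewrite (bigD1_seq k) ?mem_index_iota ?iota_uniq//= lerDl sumr_ge0.
rewrite (le_trans _ (_ : 1 + 1 <= _)) ?lerDl//.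
have := hn k nk; have := hn k.+1 (leqW nk); rewrite /= big_nat_recr//= => h1 h2.
have -> : u k = (l - \sum_(m <= i < k) u i) - (l - (\sum_(m <= i < k) u i + u k)).
  by ring.
by rewrite (le_trans (ler_normB _ _))// lerD// ltW.
Qed.

(** Convergence on two circles, one on each side of the circle of radius [rho],
bounds the terms on that circle geometrically on both sides. *)
Lemma laurent_eq0 (d : int -> R[i]) (r1 rho r2 : R) :
  0 <= r1 -> r1 < rho -> rho < r2 ->
  (forall x : R[i], r1%:C < `|x| < r2%:C -> laurent_at d x 0) -> d =1 (fun=> 0).
Proof.
move=> r10 r1rho rhor2 hd.
have rho0 : 0 < rho by lra.
have [a [r1a arho]] : exists a, r1 < a /\ a < rho by exists ((r1 + rho) / 2); lra.
have [b [rhob br2]] : exists b, rho < b /\ b < r2 by exists ((rho + r2) / 2); lra.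
have a0 : 0 < a by lra.
have b0 : 0 < b by lra.
have normR (x : R) : 0 < x -> `|x%:C| = x%:C by move=> x0; rewrite ger0_norm// ler0c ltW.
have [gpb [_ [hpb _ _]]] : laurent_at d b%:C 0.
  by apply: hd; rewrite normR// !ltcR br2 (lt_trans r1rho).
have [_ [gma [_ hma _]]] : laurent_at d a%:C 0.
  by apply: hd; rewrite normR// !ltcR r1a (lt_trans arho).
have [B B0 hB] := bounded_terms hpb.
have [B' B'0 hB'] := bounded_terms hma.
pose t := Num.max (rho / b) (a / rho).
have t0 : 0 <= t by rewrite /t le_max divr_ge0// ltW.
have t1 : t < 1 by rewrite /t gt_max !ltr_pdivrMr// !mul1r rhob arho.
have rhoC0 : 0 < rho%:C by rewrite -(rmorph0 (real_complex R)) ltcR.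
have aC0 : 0 < a%:C by rewrite -(rmorph0 (real_complex R)) ltcR.
have bC0 : 0 < b%:C by rewrite -(rmorph0 (real_complex R)) ltcR.
have h : (fun k => d k * rho%:C ^ k) =1 (fun=> 0).
  apply: (@laurent_circle_eq0 _ (B + B') t%:C); rewrite ?ler0c//.
  - by rewrite -[1](rmorph1 (real_complex R)) ltcR.
  - have le_t (s : R) n : 0 <= s -> s <= t -> s%:C ^+ n <= t%:C ^+ n.
      by move=> s0 st; rewrite lerXn2r// ?nnegrE ?ler0c// lecR.
    case=> n.
      rewrite absz_nat normrM norm_expz normR// -exprnP.
      have /hB : (0 <= n)%N by [].
      rewrite normrM norm_expz normR// -exprnP => hn.
      have -> : rho%:C ^+ n = b%:C ^+ n * (rho / b)%:C ^+ n.
        by rewrite -exprMn -rmorphM/= mulrC divfK// gt_eqF.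
      have s0 : 0 <= rho / b by rewrite divr_ge0// ltW.
      rewrite mulrA; apply: ler_pM.
      + by rewrite mulr_ge0// exprn_ge0// ltW.
      + by rewrite exprn_ge0// ler0c.
      + by apply: (le_trans hn); rewrite lerDl.
      + by rewrite le_t// /t le_max lexx.
    rewrite NegzE abszN absz_nat normrM norm_expz normR//.
    have /hB' : (0 < n.+1)%N by [].
    rewrite normrM norm_expz normR// -!invr_expz -!exprnP => hn.
    have -> : (rho%:C ^+ n.+1)^-1 = (a%:C ^+ n.+1)^-1 * (a / rho)%:C ^+ n.+1.
      rewrite rmorphM fmorphV/= exprMn exprVn mulrA mulVf ?mul1r//.
      by rewrite expf_neq0// gt_eqF.
    have s0 : 0 <= a / rho by rewrite divr_ge0// ltW.
    rewrite mulrA; apply: ler_pM.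
    + by rewrite mulr_ge0// invr_ge0 exprn_ge0// ltW.
    + by rewrite exprn_ge0// ler0c.
    + by apply: (le_trans hn); rewrite lerDr.
    + by rewrite le_t// /t le_max lexx orbT.
  - move=> z z1; apply: laurent_at_dilate; first by rewrite gt_eqF.
    by apply: hd; rewrite normrM z1 mul1r normR// !ltcR r1rho.
move=> k; have /eqP := h k; rewrite mulf_eq0 => /orP[/eqP//|].
by rewrite expfz_eq0 (gt_eqF rhoC0) andbF.
Qed.

Lemma laurent_coef_eq (g : R[i] -> R[i]) (rho : R) (c : int -> R[i]) :
  is_laurent g rho c -> laurent_coef g rho = c.
Proof.
move=> hc; apply: xget_unique => // c' [r1' [r2' [h1' h2' h3' hg']]].
case: hc => r1 [r2 [h1 h2 h3 hg]].
have h : (fun k => 1 * c' k + (-1) * c k) =1 (fun=> 0).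
  apply: (@laurent_eq0 _ (Num.max r1 r1') rho (Num.min r2 r2')).
  - by rewrite le_max h1.
  - by rewrite gt_max h2.
  - by rewrite lt_min h3.
  move=> x; have [y y0 xy] := norm_real_complex x.
  rewrite xy !ltcR gt_max lt_min => /andP[/andP[a1 a2] /andP[a3 a4]].
  have -> : 0 = 1 * g x + (-1) * g x :> R[i] by ring.
  by apply: laurent_at_lin; [apply: hg'|apply: hg]; rewrite xy !ltcR ?a1 ?a2.
apply/funext => k; have := h k; rewrite mul1r mulN1r => /eqP.
by rewrite subr_eq0 => /eqP.
Qed.

End LaurentUnique.

(** * The odd kernel *)

Section OddKernel.
Variables (R : realType) (p : R[i]).
Hypothesis (p0 : p != 0) (p1 : `|p| < 1).
Implicit Types (u v : R[i]).

(** The sum of [geo (v * p ^ l)] over all integers l, made convergent: as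
[geo v^-1 = - 1 - geo v], the term of a negative index -l is written
[- geo (v^-1 * p ^+ l)] and its constant -1 dropped. The halves share the
term l = 0 symmetrically, which makes the function odd under [v -> v^-1]. *)
Definition odd_kernel v : R[i] :=
  (geo_sum p v - 2^-1 * geo v) - (geo_sum p v^-1 - 2^-1 * geo v^-1).

(** The value 1/2 at 0 is what the symmetric treatment of the term l = 0 leaves. *)
Definition odd_kernel_coef (k : int) : R[i] :=
  if k == 0 then 2^-1 else (1 - p ^ k)^-1.

Lemma geo_inv v : v != 0 -> v != 1 -> geo v^-1 = - 1 - geo v.
Proof.
move=> v0 v1; rewrite /geo; have h : 1 - v != 0 by rewrite subr_eq0 eq_sym.
have h' : v - 1 != 0 by rewrite subr_eq0.
by field; rewrite v0 h h'.
Qed.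

Lemma odd_kernel_inv v : odd_kernel v^-1 = - odd_kernel v.
Proof. by rewrite /odd_kernel invrK [RHS]opprB. Qed.

Lemma one_sub_expz_neq0 (k : int) : k != 0 -> 1 - p ^ k != 0.
Proof.
case: k => [[|k]|k] // _; first exact: one_sub_expr_neq0.
rewrite NegzE -exprz_inv -exprnP subr_eq0 exprVn eq_sym invr_eq1 eq_sym -subr_eq0.
exact: one_sub_expr_neq0.
Qed.

(** Oddness of the kernel on coefficients: the expansions inside and outside the
unit circle differ by the constant sequence 1, the Laurent series of a delta
function, due to the pole at 1. *)
Lemma odd_kernel_coefN k : odd_kernel_coef (- k) = 1 - odd_kernel_coef k.
Proof.
rewrite /odd_kernel_coef oppr_eq0; case: eqVneq => [_|k0]; first by field.
have h1 := one_sub_expz_neq0 k0; have pk : p ^ k != 0 by rewrite expfz_neq0.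
rewrite -invr_expz; have -> : 1 - (p ^ k)^-1 = - (1 - p ^ k) / p ^ k by field.
by field; rewrite h1 pk.
Qed.

(** Both arguments of the Lambert series are in the unit disc precisely on this
annulus; the term l = 0 of the second half is taken out to reach it. *)
Lemma odd_kernel_lambert v : `|p| < `|v| -> `|v| < 1 ->
  odd_kernel v = 2^-1 + lambert p v - lambert p (v^-1 * p).
Proof.
move=> pv v1.
have v0 : v != 0 by rewrite -normr_gt0 (le_lt_trans _ pv).
have vn1 : v != 1 by apply: contraTneq v1 => ->; rewrite normr1 ltxx.
rewrite /odd_kernel (geo_sum_shift p1 v^-1) !geo_sum_lambert//.
  by rewrite geo_inv//; field.
by rewrite normrM normfV mulrC ltr_pdivrMr ?normr_gt0// mul1r.
Qed.

Lemma odd_kernel_laurent_in v : `|p| < `|v| -> `|v| < 1 ->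
  laurent_at odd_kernel_coef v (odd_kernel v).
Proof.
move=> pv v1.
have v0 : v != 0 by rewrite -normr_gt0 (le_lt_trans _ pv).
have pv1 : `|v^-1 * p| < 1.
  by rewrite normrM normfV mulrC ltr_pdivrMr ?normr_gt0// mul1r.
rewrite odd_kernel_lambert//.
exists (2^-1 + lambert p v), (- lambert p (v^-1 * p)); split; last by [].
- apply: (cvgC_eq (cvgC_lin 1 1 (cvgC_cst 2^-1) (lambert_cvg p1 v1))).
    by rewrite !mul1r.
  move=> n n0; rewrite [RHS]big_ltn// !mul1r expr0z mulr1; congr (_ + _).
  apply: eq_big_nat => k /andP[k0 _]; rewrite /odd_kernel_coef.
  by rewrite eqz_nat gtn_eqF// mulrC.
- have h := lambert_cvg p1 pv1.
  apply: (cvgC_eq (cvgC_lin 0 (-1) h h)); first by rewrite mul0r add0r mulN1r.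
  move=> n n0; rewrite mul0r add0r mulN1r -sumrN.
  apply: eq_big_nat => k /andP[k0 _]; rewrite odd_kernel_coefN /odd_kernel_coef.
  rewrite eqz_nat gtn_eqF// exprMn -invr_expz -!exprnP exprVn.
  have h1 := one_sub_expr_neq0 p1 k0.
  have h2 : v ^+ k != 0 by rewrite expf_neq0.
  by field; rewrite h1 h2.
Qed.

(** Obtained from [odd_kernel_laurent_in] at [v^-1], by oddness. *)
Lemma odd_kernel_laurent_out v : 1 < `|v| -> `|p| * `|v| < 1 ->
  laurent_at (fun k => odd_kernel_coef k - 1) v (odd_kernel v).
Proof.
move=> v1 pv.
have v0 : 0 < `|v| by rewrite (lt_trans _ v1).
have h : laurent_at odd_kernel_coef v^-1 (odd_kernel v^-1).
  apply: odd_kernel_laurent_in; rewrite normfV.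
    by rewrite -[X in _ < X]mul1r ltr_pdivlMr.
  by rewrite invf_lt1.
have := laurent_at_lin (-1) 0 (laurent_at_inv h) (laurent_at_inv h).
rewrite odd_kernel_inv mul0r addr0 mulN1r opprK; apply: laurent_at_ext => k.
by rewrite odd_kernel_coefN; ring.
Qed.

End OddKernel.

(** * Powers of q *)

Section Exponential.
Variable R : realType.
Implicit Types (z w lnq q : R[i]).

Lemma expCD z w : expC (z + w) = expC z * expC w.
Proof.
case: z w => [a b] [c d]; apply/eqP; rewrite eq_complex /expC /=.
by rewrite expRD cosD sinD; apply/andP; split; apply/eqP; ring.
Qed.

Lemma expC0 : expC (0 : R[i]) = 1.
Proof.
by apply/eqP; rewrite eq_complex /expC /= expR0 cos0 sin0 !mul0r !mul1r subr0 addr0 !eqxx.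
Qed.

Lemma expC_mulz z (k : int) : expC (z *~ k) = expC z ^ k.
Proof.
have hn n : expC (z *+ n) = expC z ^+ n.
  by elim: n => [|n IH]; rewrite ?mulr0n ?expC0// mulrS expCD IH exprS.
case: k => n; first exact: hn.
have h : expC (z *~ Negz n) * expC z ^+ n.+1 = 1.
  by rewrite -hn -expCD NegzE mulrNz addNr expC0.
have u : expC z ^+ n.+1 != 0.
  by apply/eqP => z0; move/eqP: h; rewrite z0 mulr0 eq_sym oner_eq0.
by apply: (mulIf u); rewrite h NegzE -invr_expz -exprnP mulVf.
Qed.

(** The half-integral powers of q only enter the kernel through their squares,
which do not depend on the choice of the logarithm. *)
Lemma qpow_sqr lnq (c : R) (k : int) : c + c = k%:~R ->
  qpow lnq c ^+ 2 = expC lnq ^ k.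
Proof.
move=> ck; rewrite expr2 /qpow -expCD -mulrDl -rmorphD/= ck -expC_mulz.
by rewrite rmorph_int mulrzl.
Qed.

End Exponential.

(** * Formal sums of modes *)

Section FormalModes.
Variable R : realType.

Lemma eq_formal_sum (F G : int -> fseries R) : F =1 G -> formal_sum F = formal_sum G.
Proof. by move=> /funext ->. Qed.

(** The two families have the same nonzero terms, so that the convention for
infinite supports applies to both or to none. The sign [s] chooses the orientation of the reindexing. *)
Lemma formal_sum_even_ext (d : int -> R[i]) (F : int -> fseries R) (s : int) :
  s * s = 1 ->
  formal_sum (fun k => (even_ext d k *: F k : fseries R)) =
  formal_sum (fun r => (d (s * r) *: F (2 * (s * r)) : fseries R)).
Proof.
move=> ss; apply/funext => M; rewrite /formal_sum.
have inj : set_inj [set: int] (fun r => 2 * (s * r)).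
  move=> r r' _ _ /= h.
  have : s * r = s * r' by lia.
  by move=> /(congr1 ( *%R s)); rewrite !mulrA ss !mul1r.
rewrite -(fsbig_widen ((fun r => 2 * (s * r)) @` [set: int])) //.
  rewrite (fsbig_image _ _ _ inj); apply: eq_fsbigr => r _.
  congr (_ * _); rewrite /even_ext.
  by have [-> ->] : (2 %| 2 * (s * r))%Z = true /\ (2 * (s * r) %/ 2)%Z = s * r by split; lia.
move=> k [_ hk]; rewrite /= /even_ext; case: ifPn => [k2|_]; last exact: mul0r.
case: hk; exists (s * (k %/ 2)%Z) => //=; rewrite [s * (s * _)]mulrA ss mul1r; lia.
Qed.

Lemma smode2C (i j : nat) (n m : int) : smode2 R i n j m = smode2 R j m i n.
Proof.
apply/funext => M; rewrite /smode2; congr ((_ == _)%:R).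
exact: msetDC.
Qed.

Definition mode_sum (i j : nat) (n m : int) (d : int -> R[i]) : fseries R :=
  formal_sum (fun r => (d r *: smode2 R i (n - 2 * r) j (m + 2 * r) : fseries R)).

Lemma eq_mode_sum (i j : nat) (n m : int) (d d' : int -> R[i]) :
  d =1 d' -> mode_sum i j n m d = mode_sum i j n m d'.
Proof. by move=> /funext ->. Qed.

(** A monomial determines the unordered pair of its two factors, hence r up to the
exchange of these factors. *)
Lemma smode2_finite (i j : nat) (n m : int) (M : {mset (nat * int)%type}%mset) :
  exists A : {fset int}, forall r, r \notin A ->
    smode2 R i (n - 2 * r) j (m + 2 * r) M = 0.
Proof.
have [[r0 /eqP ->]|h] := pselect (exists r0,
    M == [mset (i, (n - 2 * r0)%R); (j, (m + 2 * r0)%R)]%mset); last first.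
  exists fset0 => r _; rewrite /smode2; case: eqP => // e; case: h.
  by exists r; apply/eqP.
exists [fset r0; ((n - m - 2 * r0) %/ 2)%Z]%fset => r.
rewrite !inE negb_or => /andP[/eqP h1 /eqP h2]; rewrite /smode2; case: eqP => // e.
have := mset21 (i, (n - 2 * r)%R) (j, (m + 2 * r)%R).
rewrite -e in_mset2 => /orP[] /eqP[]; lia.
Qed.

Lemma mode_sum_lin (i j : nat) (n m : int) (a b : R[i]) (d d' : int -> R[i]) :
  mode_sum i j n m (fun r => a * d r + b * d' r) =
  a *: mode_sum i j n m d + b *: mode_sum i j n m d'.
Proof.
apply/funext => M; have [A hA] := smode2_finite i j n m M.
have sumE (f : int -> R[i]) : mode_sum i j n m f M =
    \sum_(r <- A) f r * smode2 R i (n - 2 * r) j (m + 2 * r) M.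
  rewrite /mode_sum /formal_sum (fsbigTE A)// => r rA.
  by rewrite -[LHS]/(f r * smode2 R i (n - 2 * r) j (m + 2 * r) M) hA// mulr0.
transitivity (a * mode_sum i j n m d M + b * mode_sum i j n m d' M) => //.
rewrite !sumE !mulr_sumr -big_split/=; apply: eq_bigr => r _; ring.
Qed.

Lemma mode_integralE (g : R[i] -> R[i]) (rz rw : R) (d : int -> R[i]) (i j : nat)
    (n m : int) : is_laurent g (rw / rz) (even_ext d) ->
  mode_integral g rz rw i j n m = mode_sum i j n m (fun r => d (- r)).
Proof.
move=> h; rewrite /mode_integral /oint2 /kernel_mul (laurent_coef_eq h) /gen2.
have ss : (-1) * (-1) = 1 :> int by [].
have := formal_sum_even_ext d (fun k => smode2 R i (0 + n + k) j (0 + m - k)) ss.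
move=> e; apply: (eq_trans e).
apply: eq_formal_sum => r.
have -> : 0 + n + 2 * (-1 * r) = n - 2 * r by ring.
have -> : 0 + m - 2 * (-1 * r) = m + 2 * r by ring.
by rewrite mulN1r.
Qed.

Lemma mode_sumC (i j : nat) (n m : int) (d : int -> R[i]) :
  mode_sum j i m n d = mode_sum i j n m (fun r => d (- r)).
Proof.
have sumN (F : int -> fseries R) : formal_sum F = formal_sum (fun r => F (- r)).
  apply/funext => M; apply: (reindex_fsbigT (fun r : int => - r)).
  by exists (fun r : int => - r) => r; rewrite opprK.
apply: (eq_trans (sumN _)); apply: eq_formal_sum => r.
rewrite smode2C.
have -> : n + 2 * - r = n - 2 * r by ring.
by have -> : m - 2 * - r = m + 2 * r by ring.
Qed.

End FormalModes.

(** * The fused kernel *)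

Section FusedKernel.
Variables (R : realType) (N : nat) (q lnq : R[i]).
Hypotheses (N2 : (2 <= N)%N) (q0 : 0 < `|q|) (q1 : `|q| < 1) (lnqE : expC lnq = q).

Local Notation p := (q ^+ (2 * N)).
Local Notation U := (odd_kernel p).

Lemma q_neq0 : q != 0. Proof. by rewrite -normr_gt0. Qed.

Lemma p_neq0 : p != 0. Proof. by rewrite expf_neq0// q_neq0. Qed.

Lemma p_lt1 : `|p| < 1.
Proof. by rewrite normrX exprn_ilt1// muln_eq0 -lt0n (ltnW N2). Qed.

(** The three correction terms of the kernel subtract half of the l = 0 term
from each of the three sums. *)
Lemma kernel_halfE x : let T v := geo_sum p v - 2^-1 * geo v in
  kernel_half N q x =
  2 * T (x ^+ 2) - T (x ^+ 2 * q ^+ 2) - T (x ^+ 2 * q ^- 2).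
Proof.
move=> T; rewrite /kernel_half; set S := csum _.
suff -> : S = 2 * geo_sum p (x ^+ 2) - geo_sum p (x ^+ 2 * q ^+ 2)
              - geo_sum p (x ^+ 2 * q ^- 2) by rewrite /T; field.
have h v := geo_sum_cvg p_lt1 v.
have := cvgC_lin 1 (-1) (cvgC_lin 2 (-1) (h (x ^+ 2)) (h (x ^+ 2 * q ^+ 2)))
           (h (x ^+ 2 * q ^- 2)).
rewrite mul1r !mulN1r => hS; apply: cvgC_lim; apply: (cvgC_eq hS (erefl _)) => n _.
rewrite mul1r !mulN1r mulr_sumr -!sumrN -!big_split/=; apply: eq_bigr => l _.
have E k : q ^ ((2 * N * l)%N%:Z + k) = q ^ k * p ^+ l.
  by rewrite expfzDr ?q_neq0// mulrC -exprM -exprnP.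
by rewrite -[X in _ = 2 * geo (_ * q ^ X) - _ - _]addr0 !E expr0z mul1r !mulrA.
Qed.

Lemma kernel_fE x : x != 0 -> kernel_f N q lnq x =
  - 2 * lnq * (2 * U (x ^+ 2) - U (x ^+ 2 * q ^+ 2) - U (x ^+ 2 * q ^- 2)).
Proof.
move=> x0; rewrite /kernel_f !kernel_halfE; congr (_ * _).
have -> : x^-1 ^+ 2 = (x ^+ 2)^-1 by rewrite exprVn.
have -> : (x ^+ 2)^-1 * q ^+ 2 = (x ^+ 2 * q ^- 2)^-1 by rewrite [RHS]invfM invrK.
have -> : (x ^+ 2)^-1 * q ^- 2 = (x ^+ 2 * q ^+ 2)^-1 by rewrite [RHS]invfM.
by rewrite /odd_kernel; ring.
Qed.

(** The summand is minus a second difference with step 2, and both indices move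
its argument by steps of 2, so that each of the two sums telescopes. *)
Lemma second_difference_sum (G : int -> R[i]) (i j : nat) :
  \sum_(a < i) \sum_(b < j)
    (2 * G (2 * b%:Z - 2 * a%:Z + i%:Z - j%:Z)
     - G (2 * b%:Z - 2 * a%:Z + i%:Z - j%:Z + 2)
     - G (2 * b%:Z - 2 * a%:Z + i%:Z - j%:Z - 2)) =
  G (i%:Z - j%:Z) + G (j%:Z - i%:Z) - G (i%:Z + j%:Z) - G (- i%:Z - j%:Z).
Proof.
have inner s (n : nat) : \sum_(b < n)
    (2 * G (s + 2 * b%:Z) - G (s + 2 * b%:Z + 2) - G (s + 2 * b%:Z - 2)) =
    (G s - G (s - 2)) - (G (s + 2 * n%:Z) - G (s + 2 * n%:Z - 2)).
  elim: n => [|n IH]; first by rewrite big_ord0 mulr0 addr0 subrr.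
  rewrite big_ord_recr/= IH.
  have -> : s + 2 * n.+1%:Z = s + 2 * n%:Z + 2 by lia.
  have -> : s + 2 * n%:Z + 2 - 2 = s + 2 * n%:Z by lia.
  by ring.
have outer s t (n : nat) : \sum_(a < n)
    ((G (s - 2 * a%:Z) - G (s - 2 * a%:Z - 2)) -
     (G (t - 2 * a%:Z) - G (t - 2 * a%:Z - 2))) =
    G s - G (s - 2 * n%:Z) - G t + G (t - 2 * n%:Z).
  elim: n => [|n IH]; first by rewrite big_ord0 mulr0 !subr0; ring.
  rewrite big_ord_recr/= IH.
  have -> : s - 2 * n.+1%:Z = s - 2 * n%:Z - 2 by lia.
  have -> : t - 2 * n.+1%:Z = t - 2 * n%:Z - 2 by lia.
  by ring.
have := outer (i%:Z - j%:Z) (i%:Z + j%:Z) i.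
have -> : i%:Z - j%:Z - 2 * i%:Z = - i%:Z - j%:Z by lia.
have -> : i%:Z + j%:Z - 2 * i%:Z = j%:Z - i%:Z by lia.
move=> h; transitivity (G (i%:Z - j%:Z) - G (- i%:Z - j%:Z) - G (i%:Z + j%:Z)
  + G (j%:Z - i%:Z)); last by ring.
rewrite -h; apply: eq_bigr => a _.
have e : i%:Z + j%:Z - 2 * a%:Z = (i%:Z - j%:Z - 2 * a%:Z) + 2 * j%:Z by lia.
rewrite e -inner; apply: eq_bigr => b _.
by have -> : 2 * b%:Z - 2 * a%:Z + i%:Z - j%:Z = i%:Z - j%:Z - 2 * a%:Z + 2 * b%:Z by lia.
Qed.

(** As f only depends on the square of its argument, the points of the double sum
enter through integral powers of q whose exponents move by 2 with either index;
the sum is then the one of [second_difference_sum]. *)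
Lemma kernel_fijE (i j : nat) x : x != 0 -> kernel_fij N q lnq i j x =
  - 2 * lnq * (U (x ^+ 2 * q ^ (i%:Z - j%:Z)) + U (x ^+ 2 * q ^ (j%:Z - i%:Z))
    - U (x ^+ 2 * q ^ (i%:Z + j%:Z)) - U (x ^+ 2 * q ^ (- i%:Z - j%:Z))).
Proof.
move=> x0; rewrite -(second_difference_sum (fun e => U (x ^+ 2 * q ^ e))).
rewrite mulr_sumr; apply: eq_bigr => a _; rewrite mulr_sumr; apply: eq_bigr => b _.
set c := centered R j b - centered R i a; set e := 2 * b%:Z - 2 * a%:Z + i%:Z - j%:Z.
have cE : qpow lnq c ^+ 2 = q ^ e.
  rewrite -lnqE; apply: qpow_sqr.
  by rewrite /c /e /centered !rmorphD !rmorphN !rmorphM /=; field.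
have w0 : qpow lnq c != 0 by rewrite -sqrf_eq0 cE expfz_neq0// q_neq0.
rewrite (kernel_fE (mulf_neq0 w0 x0)).
have -> : (qpow lnq c * x) ^+ 2 = x ^+ 2 * q ^ e by rewrite exprMn cE mulrC.
have -> : q ^- 2 = q ^ (- 2) by [].
by rewrite !expfzDr ?q_neq0// !mulrA.
Qed.

(** * Laurent coefficients of the fused kernel *)

Lemma normq_expz_le1 (e : int) : 0 <= e -> `|q| ^ e <= 1.
Proof.
case: e => // n _; rewrite -exprnP; apply: exprn_ile1 => //; exact: ltW.
Qed.

Lemma normqD (a b : int) : `|q| ^ (a + b) = `|q| ^ a * `|q| ^ b.
Proof. by rewrite expfzDr// gt_eqF. Qed.

Lemma normq_expz_gt0 (e : int) : 0 < `|q| ^ e. Proof. exact: exprz_gt0. Qed.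

Lemma normq_expz_le (a b : int) : a <= b -> `|q| ^ b <= `|q| ^ a.
Proof.
move=> ab; rewrite -[b](subrK a) normqD ler_piMl ?(ltW (normq_expz_gt0 _))//.
by rewrite normq_expz_le1// subr_ge0.
Qed.

(** The flag [s] tells that [y * q ^ e] is outside the unit circle; the conditions on
[e] keep it in the annulus between that circle and the next pole. *)
Lemma odd_kernel_laurent (alpha beta e : int) (s : bool) (y : R[i]) :
  `|q| ^ alpha < `|y| -> `|y| < `|q| ^ beta ->
  (if s then (alpha + e <= 0) && (0 <= (2 * N)%N%:Z + beta + e)
   else (0 <= beta + e) && (alpha + e <= (2 * N)%N%:Z)) ->
  laurent_at (fun k => (odd_kernel_coef p k - s%:R) * (q ^ e) ^ k) y (U (y * q ^ e)).
Proof.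
move=> hl hu he; apply: laurent_at_dilate; first by rewrite expfz_neq0 ?q_neq0.
have p0 := p_neq0; have p1 := p_lt1.
have nyq : `|y * q ^ e| = `|y| * `|q| ^ e by rewrite normrM norm_expz.
have np : `|p| = `|q| ^ (2 * N)%N%:Z by rewrite normrX.
have e0 := normq_expz_gt0 e.
have hl' : `|q| ^ (alpha + e) < `|y * q ^ e| by rewrite nyq normqD ltr_pM2r.
have hu' : `|y * q ^ e| < `|q| ^ (beta + e) by rewrite nyq normqD ltr_pM2r.
case: s he => /andP[h1 h2].
  apply: odd_kernel_laurent_out => //.
    by apply: le_lt_trans hl'; rewrite -[X in X <= _](expr0z `|q|) normq_expz_le.
  rewrite np (lt_le_trans (_ : _ < `|q| ^ (2 * N)%N%:Z * `|q| ^ (beta + e)))//.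
    by rewrite ltr_pM2l// normq_expz_gt0.
  by rewrite -normqD normq_expz_le1// addrA.
apply: (@laurent_at_ext _ (odd_kernel_coef p)) => [k|]; first by rewrite subr0.
apply: odd_kernel_laurent_in => //.
  by rewrite np; apply: le_lt_trans hl'; rewrite normq_expz_le.
by apply: lt_le_trans hu' _; rewrite normq_expz_le1.
Qed.

Definition structure_coef (i j : nat) (r : int) : R[i] :=
  if r == 0 then 0
  else qint q ((N - maxn i j)%:Z * r) * qint q ((minn i j)%:Z * r)
       / qint q (N%:Z * r).

(** For r <> 0, with a, b, c the r-th powers of q^i, q^j, q^N, the four terms with
coefficient e = 1 / (1 - c^2) add up to -(a - 1/a)(b - 1/b) / (1 - c^2); adding the terms
without e turns the factor b - 1/b into the one of N - j. *)
Lemma structure_coefE (i j : nat) (r : int) : (i <= j < N)%N ->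
  let e := odd_kernel_coef p r in
  (e - 1) * (q ^ (i%:Z - j%:Z)) ^ r + e * (q ^ (j%:Z - i%:Z)) ^ r
  - e * (q ^ (i%:Z + j%:Z)) ^ r - (e - 1) * (q ^ (- i%:Z - j%:Z)) ^ r =
  - (q - q^-1) * structure_coef i j r.
Proof.
case/andP=> ij jN e; rewrite {}/e /odd_kernel_coef /structure_coef.
case: eqVneq => [->|r0]; first by rewrite !expr0z mulr0; field.
rewrite (maxn_idPr ij) (minn_idPl ij) /qint.
have -> : (N - j)%N%:Z = N%:Z - j%:Z by lia.
set a := q ^ (i%:Z * r); set b := q ^ (j%:Z * r); set c := q ^ (N%:Z * r).
have a0 : a != 0 by rewrite expfz_neq0 ?q_neq0.
have b0 : b != 0 by rewrite expfz_neq0 ?q_neq0.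
have c0 : c != 0 by rewrite expfz_neq0 ?q_neq0.
have pr : p ^ r = c ^+ 2.
  by rewrite /c (exprnP q) (exprnP (q ^ _)) !exprz_exp; congr (q ^ _); lia.
have c1 : 1 - c ^+ 2 != 0.
  by rewrite -pr; apply: one_sub_expz_neq0 => //; rewrite ?p_neq0 ?p_lt1.
have d0 : q - q^-1 != 0.
  have := one_sub_expr_neq0 q1 (isT : (0 < 2)%N); apply: contraNneq => h.
  have -> : 1 - q ^+ 2 = - q * (q - q^-1) by field; rewrite q_neq0.
  by rewrite h mulr0.
have -> : (q ^ (i%:Z - j%:Z)) ^ r = a / b.
  by rewrite exprz_exp mulrBl expfzDr ?q_neq0// -invr_expz.
have -> : (q ^ (j%:Z - i%:Z)) ^ r = b / a.
  by rewrite exprz_exp mulrBl expfzDr ?q_neq0// -invr_expz.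
have -> : (q ^ (i%:Z + j%:Z)) ^ r = a * b.
  by rewrite exprz_exp mulrDl expfzDr ?q_neq0.
have -> : (q ^ (- i%:Z - j%:Z)) ^ r = (a * b)^-1.
  by rewrite -opprD exprz_exp mulNr -invr_expz mulrDl expfzDr ?q_neq0.
have -> : q ^ ((N%:Z - j%:Z) * r) = c / b.
  by rewrite mulrBl expfzDr ?q_neq0// -invr_expz.
have -> : q ^ (- ((N%:Z - j%:Z) * r)) = b / c.
  by rewrite -mulNr opprB mulrBl expfzDr ?q_neq0// -invr_expz.
rewrite -![q ^ (- _)]invr_expz -/a -/c pr.
move: (q - q^-1) d0 => d d0.
have c2 : c - c^-1 != 0.
  apply: contraNneq c1 => h; have -> : 1 - c ^+ 2 = - c * (c - c^-1) by field.
  by rewrite h mulr0.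
have c3 : c ^+ 2 - 1 != 0 by rewrite -opprB oppr_eq0.
have -> : (c - c^-1) / d = (c ^+ 2 - 1) / (c * d) by field; rewrite d0 c0.
by field; rewrite ?a0 ?b0 ?c0 ?c1 ?c3 ?d0.
Qed.

Lemma structure_coefN (i j : nat) (r : int) :
  structure_coef i j (- r) = - structure_coef i j r.
Proof.
rewrite /structure_coef oppr_eq0; case: ifP => _; first by rewrite oppr0.
have qintN k : qint q (- k) = - qint q k by rewrite /qint opprK -mulNr opprB.
by rewrite !mulrN !qintN mulrNN invrN mulrN.
Qed.

Lemma structure_coefC (i j : nat) (r : int) :
  structure_coef i j r = structure_coef j i r.
Proof. by rewrite /structure_coef maxnC minnC. Qed.

Lemma kernel_fij_laurent_lin (i j : nat) (x : R[i]) (c1 c2 c3 c4 : int -> R[i]) :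
  x != 0 ->
  laurent_at c1 (x ^+ 2) (U (x ^+ 2 * q ^ (i%:Z - j%:Z))) ->
  laurent_at c2 (x ^+ 2) (U (x ^+ 2 * q ^ (j%:Z - i%:Z))) ->
  laurent_at c3 (x ^+ 2) (U (x ^+ 2 * q ^ (i%:Z + j%:Z))) ->
  laurent_at c4 (x ^+ 2) (U (x ^+ 2 * q ^ (- i%:Z - j%:Z))) ->
  laurent_at (even_ext (fun r => - 2 * lnq * (c1 r + c2 r - c3 r - c4 r))) x
    (kernel_fij N q lnq i j x).
Proof.
move=> x0 h1 h2 h3 h4; apply: laurent_at_sqr; rewrite kernel_fijE//.
set K := - 2 * lnq.
have := laurent_at_lin 1 1 (laurent_at_lin K K h1 h2) (laurent_at_lin (- K) (- K) h3 h4).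
rewrite !mul1r => h.
have -> : K * (U (x ^+ 2 * q ^ (i%:Z - j%:Z)) + U (x ^+ 2 * q ^ (j%:Z - i%:Z))
    - U (x ^+ 2 * q ^ (i%:Z + j%:Z)) - U (x ^+ 2 * q ^ (- i%:Z - j%:Z))) =
  K * U (x ^+ 2 * q ^ (i%:Z - j%:Z)) + K * U (x ^+ 2 * q ^ (j%:Z - i%:Z)) +
  (- K * U (x ^+ 2 * q ^ (i%:Z + j%:Z)) + - K * U (x ^+ 2 * q ^ (- i%:Z - j%:Z))).
  by ring.
by apply: laurent_at_ext h => r; ring.
Qed.

(** Twice the smallest positive element of [Pset N i j], which is 1/2 or 1: sector 0 is
the annulus between the circles [`|x ^+ 2| = 1] and
[`|x ^+ 2| = `|q| ^+ sector_width i j] of candidate poles. *)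
Definition sector_width (i j : nat) : nat := if odd (i + j) then 1 else 2.

(** For i = j the pole at modulus 1 is present, and the expansion on the inner side
carries one half of a delta function, the constant 1. *)
Lemma kernel_fij_laurent_in (i j : nat) (x : R[i]) : (0 < i <= j)%N -> (j < N)%N ->
  `|q| ^+ sector_width i j < `|x| ^+ 2 -> `|x| < 1 ->
  laurent_at (even_ext (fun r => - 2 * lnq *
    (- (q - q^-1) * structure_coef i j r + (i == j)%:R))) x
    (kernel_fij N q lnq i j x).
Proof.
move=> /andP[i0 ij] jN hl hu.
have x0 : x != 0.
  rewrite -normr_gt0; apply: contraTT hl; rewrite -real_leNgt//.
  move=> /(conj (normr_ge0 x))/andP/le_anti <-.
  by rewrite expr0n/= lt_gtF// exprn_gt0.
have hl' : `|q| ^ (sector_width i j)%:Z < `|x ^+ 2| by rewrite normrX.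
have hu' : `|x ^+ 2| < `|q| ^ 0 by rewrite normrX expr0z exprn_ilt1.
have w1 e : (e = i%:Z - j%:Z) \/ (e = - i%:Z - j%:Z) -> e < 0 ->
    (sector_width i j)%:Z + e <= 0.
  by rewrite /sector_width => he e0; case: ifP => hodd; lia.
have w2 : (sector_width i j <= 2)%N by rewrite /sector_width; case: ifP.
have := kernel_fij_laurent_lin x0
  (@odd_kernel_laurent _ _ (i%:Z - j%:Z) (i != j) _ hl' hu' _)
  (@odd_kernel_laurent _ _ (j%:Z - i%:Z) false _ hl' hu' _)
  (@odd_kernel_laurent _ _ (i%:Z + j%:Z) false _ hl' hu' _)
  (@odd_kernel_laurent _ _ (- i%:Z - j%:Z) true _ hl' hu' _).
move=> h; apply: (laurent_at_ext _ (h _ _ _ _)).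
- move=> k; rewrite /even_ext; case: ifP => // _; congr (_ * _).
  rewrite -structure_coefE ?ij//=; case: eqVneq => [->|_].
    by rewrite subrr expr0z exp1rz !subr0 [true%:R]/=; ring.
  by rewrite !subr0 addr0.
- case: eqVneq => ijn; first by move: w2; rewrite ijn subrr /=; lia.
  by apply/andP; split; [apply: w1 | ]; lia.
- by apply/andP; split; lia.
- by apply/andP; split; lia.
- by apply/andP; split; [apply: w1 | ]; lia.
Qed.

(** Across the circle of modulus 1 the pole changes the constant from 1 to -1. *)
Lemma kernel_fij_laurent_out (i : nat) (x : R[i]) : (0 < i < N)%N ->
  1 < `|x| -> `|x| * `|q| < 1 ->
  laurent_at (even_ext (fun r => - 2 * lnq *
    (- (q - q^-1) * structure_coef i i r - 1))) x
    (kernel_fij N q lnq i i x).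
Proof.
move=> /andP[i0 iN] hl hu.
have x0 : x != 0 by rewrite -normr_gt0 (lt_trans _ hl).
have hl' : `|q| ^ 0 < `|x ^+ 2| by rewrite normrX expr0z exprn_egt1.
have hu' : `|x ^+ 2| < `|q| ^ (- 2).
  rewrite normrX -invr_expz -exprnP -[X in _ < X]mul1r ltr_pdivlMr ?exprn_gt0//.
  by rewrite -exprMn exprn_ilt1// mulr_ge0.
have := kernel_fij_laurent_lin x0
  (@odd_kernel_laurent _ _ (i%:Z - i%:Z) true _ hl' hu' _)
  (@odd_kernel_laurent _ _ (i%:Z - i%:Z) true _ hl' hu' _)
  (@odd_kernel_laurent _ _ (i%:Z + i%:Z) false _ hl' hu' _)
  (@odd_kernel_laurent _ _ (- i%:Z - i%:Z) true _ hl' hu' _).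
move=> h; apply: (laurent_at_ext _ (h _ _ _ _)).
- move=> k; rewrite /even_ext; case: ifP => // _; congr (_ * _).
  rewrite -structure_coefE ?leqnn//= subrr expr0z exp1rz !subr0; ring.
- by apply/andP; split; lia.
- by apply/andP; split; lia.
- by apply/andP; split; lia.
- by apply/andP; split; lia.
Qed.

(** * The sector k = 0 *)

Local Notation Q := (complex.Re `|q|).

Lemma Re_normE (z : R[i]) : (complex.Re `|z|)%:C = `|z|.
Proof. by rewrite RRe_real// normr_real. Qed.

Lemma Q_gt0 : 0 < Q.
Proof. by rewrite -ltcR Re_normE (rmorph0 (real_complex R)). Qed.

Lemma Q_lt1 : Q < 1.
Proof. by rewrite -ltcR Re_normE (rmorph1 (real_complex R)). Qed.

(** The number [sector_width i j / 2] occurs in the enumeration at a positive rank, so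
that the element of rank 1 is at most this number, which bounds the upper end of
the sector. *)
Lemma sector0_bounds (i j : nat) (rho : R) : (0 < i)%N -> (0 < j)%N ->
  sector N q i j 0 rho -> 1 < rho /\ rho ^+ 2 * Q ^+ sector_width i j < 1.
Proof.
move=> i0 j0 [P [P0 Plt PS]]; rewrite P0 oppr0 powRr0 add0r => /andP[rho1 rhoP].
split=> //; have Q0 := Q_gt0; set w := sector_width i j.
have w0 : (0 < w)%N by rewrite /w /sector_width; case: ifP.
have [k Pk] : exists k, P k = w%:R / 2.
  have : (Pset N i j : set R) (w%:R / 2).
    right; exists 0, (uphalf (i + j + w))%N.
    have e : ((uphalf (i + j + w)).*2 = i + j + w)%N.
      by rewrite /w /sector_width; case: ifP => hodd; lia.
    split; first by rewrite /w /sector_width; case: ifP => hodd; lia.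
    rewrite mulr0 add0r; apply: (mulIf (_ : 2 != 0 :> R)) => //.
    rewrite mulrDl mulNr !divfK// -natrM muln2 e (natrD _ (i + j)%N).
    by rewrite addKr.
  by rewrite -PS => -[k _ <-]; exists k.
have k1 : 1 <= k.
  rewrite -gtz0_ge1 ltNge; apply/negP => k_le0.
  have : P k <= P 0.
    by move: k_le0; rewrite le_eqVlt => /orP[/eqP ->//|/Plt/ltW].
  by rewrite Pk P0 leNgt divr_gt0// ltr0n.
have P1 : P 1 <= w%:R / 2.
  by rewrite -Pk; move: k1; rewrite le_eqVlt => /orP[/eqP ->//|/Plt/ltW].
have h : rho < Q `^ (- (w%:R / 2)).
  apply: (lt_le_trans rhoP); apply: ger_powR; last by rewrite lerN2.
  by rewrite Q0 (ltW Q_lt1).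
have h2 : rho ^+ 2 < Q ^- w.
  have -> : Q ^- w = (Q `^ (- (w%:R / 2))) ^+ 2.
    rewrite expr2 -powRD; last by rewrite (gt_eqF Q0) implybT.
    by rewrite -opprD -splitr powR_invn// ltW.
  by rewrite ltr_pXn2r// ?nnegrE ?powR_ge0// ltW// (lt_trans _ rho1).
by rewrite -ltr_pdivlMr ?exprn_gt0// mul1r.
Qed.

(** * The brackets *)

Local Notation S := structure_coef.

Lemma is_laurent_kernel_in (i j : nat) (rho : R) : (0 < i <= j)%N -> (j < N)%N ->
  1 < rho -> rho ^+ 2 * Q ^+ sector_width i j < 1 ->
  is_laurent (kernel_fij N q lnq i j) rho^-1
    (even_ext (fun r => - 2 * lnq * (- (q - q^-1) * S i j r + (i == j)%:R))).
Proof.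
move=> ij jN rho1 hrho; have Q0 := Q_gt0.
have rho0 : 0 < rho by rewrite (lt_trans _ rho1).
have Qw : 0 < Q ^+ sector_width i j by rewrite exprn_gt0.
exists (Num.sqrt (Q ^+ sector_width i j)), 1; split.
- exact: sqrtr_ge0.
- rewrite -[ltRHS]ger0_norm ?invr_ge0 ?(ltW rho0)// -sqrtr_sqr ltr_sqrt ?exprn_gt0 ?invr_gt0//.
  by rewrite exprVn -[ltRHS]mul1r ltr_pdivlMr ?exprn_gt0// mulrC.
- by rewrite invf_lt1.
move=> x; have [a a0 xa] := norm_real_complex x.
rewrite xa !ltcR => /andP[h1 h2]; apply: kernel_fij_laurent_in => //.
  rewrite xa -(Re_normE q) -!rmorphXn/= ltcR -(sqr_sqrtr (ltW Qw)).
  by rewrite ltr_pXn2r// ?nnegrE ?sqrtr_ge0.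
by rewrite xa -[1](rmorph1 (real_complex R)) ltcR.
Qed.

Lemma is_laurent_kernel_out (i : nat) (rho : R) : (0 < i < N)%N ->
  1 < rho -> rho * Q < 1 ->
  is_laurent (kernel_fij N q lnq i i) rho
    (even_ext (fun r => - 2 * lnq * (- (q - q^-1) * S i i r - 1))).
Proof.
move=> iN rho1 hrho; have Q0 := Q_gt0.
exists 1, Q^-1; split => //.
  by rewrite -[ltRHS]mul1r ltr_pdivlMr.
move=> x; have [a a0 xa] := norm_real_complex x.
rewrite xa !ltcR => /andP[h1 h2]; apply: kernel_fij_laurent_out => //.
  by rewrite xa -[1](rmorph1 (real_complex R)) ltcR.
rewrite xa -(Re_normE q) -rmorphM/= -[1](rmorph1 (real_complex R)) ltcR.
by rewrite -ltr_pdivlMr// mul1r.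
Qed.

(** For i = j the two orders of integration use the expansions on either side of the
circle of modulus 1, and the mean cancels their opposite constants. *)
Lemma bracket_leE (i j : nat) (n m : int) (R1 R2 : R) : (0 < i <= j)%N -> (j < N)%N ->
  1 < R1 / R2 -> (R1 / R2) ^+ 2 * Q ^+ sector_width i j < 1 ->
  bracket_le N q lnq R1 R2 i j n m =
  (- 2 * lnq * (q - q^-1)) *: mode_sum i j n m (S i j).
Proof.
move=> ij jN h1 h2; have := is_laurent_kernel_in ij jN h1 h2.
rewrite invf_div => /mode_integralE hin; rewrite /bracket_le hin.
set K := - 2 * lnq * (q - q^-1).
have -> : K *: mode_sum i j n m (S i j) = mode_sum i j n m (fun r => K * S i j r).
  transitivity (K *: mode_sum i j n m (S i j) + 0 *: mode_sum i j n m (S i j)).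
    by rewrite scale0r addr0.
  by rewrite -mode_sum_lin; apply: eq_mode_sum => r; rewrite mul0r addr0.
case: eqVneq => [ijE|_]; last first.
  apply: eq_mode_sum => r.
  by rewrite structure_coefN addr0 /K; ring.
subst j.
have h3 : R1 / R2 * Q < 1.
  move: h2; rewrite /sector_width addnn odd_double -exprMn.
  by rewrite expr_lt1// mulr_ge0// ?(ltW Q_gt0)// (le_trans _ (ltW h1)).
have iN : (0 < i < N)%N by case/andP: ij => -> _.
rewrite (mode_integralE _ _ _ _ (is_laurent_kernel_out iN h1 h3)).
rewrite scalerDr -mode_sum_lin; apply: eq_mode_sum => r.
by rewrite structure_coefN [true%:R]/= /K; field; rewrite q_neq0.
Qed.

End FusedKernel.

Theorem proposition3 (R : realType) (N : nat) (q lnq : R[i])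
    (hN : (2 <= N)%N) (hq : 0 < `|q| < 1) (hlnq : expC lnq = q)
    (i j : nat) (hi : (1 <= i <= N - 1)%N) (hj : (1 <= j <= N - 1)%N)
    (n m : int) (R1 R2 : R) (hR1 : 0 < R1) (hR2 : 0 < R2)
    (hsector : sector N q i j 0 (R1 / R2)) :
  bracket N q lnq R1 R2 i j n m =
  (- 2 * lnq * (q - q^-1)) *:
    formal_sum (fun r : int =>
      ((if r == 0 then 0
        else qint q ((N - maxn i j)%:Z * r) * qint q ((minn i j)%:Z * r)
             / qint q (N%:Z * r))
       *: smode2 R i (n - 2 * r) j (m + 2 * r) : fseries R)).
Proof.
case/andP: hq => q0 q1; case/andP: hi => i0 iN; case/andP: hj => j0 jN.
have [h1 h2] := sector0_bounds hN q0 q1 i0 j0 hsector.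
change (bracket N q lnq R1 R2 i j n m = (- 2 * lnq * (q - q^-1)) *:
  mode_sum i j n m (structure_coef N q i j)).
rewrite /bracket; case: leqP => ij.
  by apply: bracket_leE => //; lia.
rewrite bracket_leE//; [|lia|lia|by move: h2; rewrite /sector_width addnC].
rewrite mode_sumC -scalerN; congr (_ *: _).
pose d r := structure_coef N q j i (- r).
have -> : - mode_sum i j n m d = mode_sum i j n m (fun r => -1 * d r + 0 * d r).
  by rewrite mode_sum_lin scale0r addr0 scaleN1r.
apply: eq_mode_sum => r.
by rewrite /d structure_coefN structure_coefC mul0r addr0 mulN1r opprK.
Qed.
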